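(* Let $\mathscr{A},\mathscr{B}$ be two unital $C^*$-algebras, and let $\Phi:\mathscr{A}\to\mathscr{B}$ be a (not necessarily linear) continuous unital positive map with $\Phi(0)=0$. Suppose that $\Phi$ is either $6$-positive or in the class $S^{(4)}_{\mathrm{mon}+}$. Then: (1) if $\Phi(\alpha I)=\alpha I$ for some $\alpha\in\mathbb{C}_1\cup\mathbb{R}_+$ with $|\alpha|\neq 0,1$, then $\Phi(\beta A+B)=\beta\Phi(A)+\Phi(B)$ for every $\beta\in\mathbb{R}$ and all $A,B\in\mathscr{A}$; (2) if $\Phi\big((r+\mathrm{i}s)I\big)=(r+\mathrm{i}s)I$ for some $r,s\in\mathbb{R}$ with $0\neq|r+\mathrm{i}s|<1$ and $s\neq 0$, then $\Phi$ is linear on $\mathscr{A}$.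
   Context: Maps between $C^*$-algebras are arbitrary functions; linearity is not assumed. In (2), linear means complex-linear. $\mathbb{C}_1$ is the closed unit ball of $\mathbb{C}$ and $\mathbb{R}_+=[0,\infty)$. $\Phi$ is unital if $\Phi(I)=I$ (both units are denoted $I$). A map is positive if it sends positive elements to positive elements. For a map $\Phi:\mathscr{A}\to\mathscr{B}$ let $\Phi_n:M_n(\mathscr{A})\to M_n(\mathscr{B})$, $\Phi_n([a_{ij}])=[\Phi(a_{ij})]$, be the entrywise map. $\Phi$ is $n$-positive if $\Phi_n$ is positive. A positive map $\Phi$ is in the class $S^{(n)}_{\mathrm{mon}+}$ if $\Phi_n$ is monotone on positive elements of $M_n(\mathscr{A})$, i.e. $\Phi_n(X)\geq\Phi_n(Y)$ whenever $X\geq Y\geq 0$ in $M_n(\mathscr{A})$. Continuity is with respect to the norm topologies. *)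

(* Defs.v *)
From HB Require Import structures.
From mathcomp Require Import all_boot all_order all_algebra.
From mathcomp Require Import complex.
From mathcomp Require Import all_classical all_reals all_analysis.

Set Implicit Arguments.
Unset Strict Implicit.
Unset Printing Implicit Defensive.

Import Order.TTheory GRing.Theory Num.Theory.
Import numFieldNormedType.Exports.

Local Open Scope ring_scope.
Local Open Scope complex_scope.

(* The norm of a [completeNormedModType R[i]] is [R[i]]-valued (with
   nonnegative real values).  Hierarchy-Builder cannot join [algType R[i]] with
   [completeNormedModType R[i]], because [numDomainType] is already the join of
   rings and normed Z-modules; the multiplication is therefore part of the
   mixin, and the ring structure is derived below.  [cone = 0] is allowed. *)
HB.mixin Record isCStarAlgebra (R : realType) A
    of CompleteNormedModule R[i] A := {
  cone : A;
  cmul : A -> A -> A;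
  cmulA : associative cmul;
  cmul1r : left_id cone cmul;
  cmulr1 : right_id cone cmul;
  cmulDl : left_distributive cmul +%R;
  cmulDr : right_distributive cmul +%R;
  cscaleAl : forall (c : R[i]) (x y : A), c *: cmul x y = cmul (c *: x) y;
  cscaleAr : forall (c : R[i]) (x y : A), c *: cmul x y = cmul x (c *: y);
  star : A -> A;
  starK : involutive star;
  starD : {morph star : x y / x + y};
  starZ : forall (c : R[i]) (x : A), star (c *: x) = c^* *: star x;
  starM : forall x y : A, star (cmul x y) = cmul (star y) (star x);
  cnormM_le : forall x y : A, `|cmul x y| <= `|x| * `|y|;
  cstar_identity : forall x : A, `|cmul (star x) x| = `|x| ^+ 2
}.

#[short(type="cstarAlgType")]
HB.structure Definition CStarAlgebra (R : realType) :=
  {A of isCStarAlgebra R A & CompleteNormedModule R[i] A}.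

HB.instance Definition _ (R : realType) (A : cstarAlgType R) :=
  GRing.Zmodule_isPzRing.Build (CStarAlgebra.sort A)
    cmulA cmul1r cmulr1 cmulDl cmulDr.

Section Positivity.
Context {R : realType}.
Implicit Types A B : cstarAlgType R.

Definition cstar_pos A (a : A) : Prop := exists b : A, a = star b * b.

(* The adjoint of the C*-algebra M_n(A). *)
Definition mxstar A n (X : 'M[A]_n) : 'M[A]_n := (map_mx star X)^T.

(* Positivity in M_n(A); being of the form Y^* Y does not involve the
   C*-norm of M_n(A). *)
Definition mx_pos A n (X : 'M[A]_n) : Prop :=
  exists Y : 'M[A]_n, X = mxstar Y *m Y.

Definition mx_ge A n (X Y : 'M[A]_n) : Prop := mx_pos (X - Y).

Definition positive_map A B (Phi : A -> B) : Prop :=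
  forall a : A, cstar_pos a -> cstar_pos (Phi a).

(* [map_mx Phi] is the entrywise map Phi_n. *)
Definition n_positive n A B (Phi : A -> B) : Prop :=
  forall X : 'M[A]_n, mx_pos X -> mx_pos (map_mx Phi X).

Definition Smon_plus n A B (Phi : A -> B) : Prop :=
  positive_map Phi /\
  forall X Y : 'M[A]_n, mx_ge X Y -> mx_ge Y 0 ->
    mx_ge (map_mx Phi X) (map_mx Phi Y).

End Positivity.

(* Main.v *)
Require Import Defs.
From HB Require Import structures.
From mathcomp Require Import all_boot all_order all_algebra.
From mathcomp Require Import complex ring lra.
From mathcomp Require Import all_classical all_reals all_analysis.

Import Order.TTheory GRing.Theory Num.Theory.
Import numFieldNormedType.Exports.

Local Open Scope ring_scope.
Local Open Scope complex_scope.

(** The order of a C*-algebra is handled through the norm: a self-adjoint [h] is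
    nonnegative when [|t - h| <= t] for some real [t >= 0].  This makes the
    nonnegative elements a convex cone at once; square roots come from the iteration
    [y := (x + y^2) / 2], and the inequality [|k^2| <= |k^2 + l^2|] for commuting
    self-adjoint elements shows that squares are nonnegative, that the cone meets its
    opposite in 0 only, and that it is closed.  Kaplansky's argument then shows that
    every [z^* z] is nonnegative ([star_mul_nneg]), so a positive matrix over the
    target algebra yields nonnegative values of the form [sum k_i^* M_ij k_j]
    ([mx_pos_form]).

    Both classes of maps are 4-positive in the sense of such forms.  Evaluating the
    form of well-chosen Gram matrices with entries in the source algebra gives
    - strong superadditivity on positive elements,
      [Phi(P+Q+S) + Phi(P) >= Phi(P+Q) + Phi(P+S)];
    - the Schur complement inequality for [Phi(x^* y) - Phi(x)^* Phi(y)], hence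
      Choi's multiplicative domain: if [Phi(c) = c] and [Phi(|c|^2) = |c|^2] for a
      scalar [c], then [Phi(c y) = c Phi(y)] for all [y] ([choi_scalar]).

    On scalars, [t |-> Phi(t)] is therefore convex, equal to [t] at 0 and 1.  The extra
    fixed scalar forces [Phi(b) = b] for some [b] strictly between 0 and 1.  Then
    [Phi(b^2) = b^2], by convexity from above and by the Schwarz inequality from below,
    so [Phi] is homogeneous for [b]; convexity propagates [Phi(t) = t] to the whole
    unit interval, and Choi's argument makes [Phi] homogeneous there.

    Homogeneity and strong superadditivity make [Phi] additive on positive elements:
    the increments of [n |-> Phi(P + nQ)] grow, and divided by [n] they tend to
    [Phi(Q)] ([additive_on_positives]).  Finally an arbitrary [x] is the off-diagonal
    entry of the positive 2x2 matrix with diagonal [1], [x^* x].  In both classes the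
    2x2 amplification of [Phi] is superadditive on two such matrices
    ([superadditive2]); additivity on positive elements says that the defect has zero
    diagonal, so its off-diagonal entry [Phi(x+y) - Phi(x) - Phi(y)] vanishes.  With a
    non-real fixed scalar, Choi's argument also gives [Phi(i y) = i Phi(y)]. *)

(** * Linear identities through a commutative ring *)

(** The square-zero extension of [K] by [V], in which two vectors multiply to 0. *)
Definition sqz (K : fieldType) (V : lmodType K) : Type := (K * V)%type.

HB.instance Definition _ (K : fieldType) (V : lmodType K) :=
  GRing.Zmodule.on (sqz K V).

Section SquareZero.
Variables (K : fieldType) (V : lmodType K).

Definition sqz_mul (p q : sqz K V) : sqz K V :=
  (p.1 * q.1, p.1 *: q.2 + q.1 *: p.2).

Definition sqz_one : sqz K V := (1, 0).

Lemma sqz_mulA : associative sqz_mul.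
Proof.
move=> [a u] [b v] [c w]; congr pair => /=; first exact: mulrA.
by rewrite !scalerDr !scalerA addrA (mulrC c a) (mulrC c b).
Qed.

Lemma sqz_mulC : commutative sqz_mul.
Proof. by move=> [a u] [b v]; congr pair; [exact: mulrC | exact: addrC]. Qed.

Lemma sqz_mul1 : left_id sqz_one sqz_mul.
Proof.
by move=> [a u]; rewrite /sqz_mul /= mul1r scale1r scaler0 addr0.
Qed.

Lemma sqz_mulDl : left_distributive sqz_mul +%R.
Proof.
move=> [a u] [b v] [c w]; congr pair => /=; first exact: mulrDl.
by rewrite scalerDl scalerDr addrACA.
Qed.

Lemma sqz_neq0 : sqz_one != 0.
Proof. by rewrite xpair_eqE oner_eq0. Qed.

HB.instance Definition _ := GRing.Zmodule_isComNzRing.Build (sqz K V)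
  sqz_mulA sqz_mulC sqz_mul1 sqz_mulDl sqz_neq0.

Definition sqz_vec (v : V) : sqz K V := (0, v).

Definition sqz_scal (a : K) : sqz K V := (a, 0).

Lemma sqz_vec_is_additive : additive sqz_vec.
Proof. by move=> u v; congr pair; rewrite subr0. Qed.

HB.instance Definition _ :=
  GRing.isAdditive.Build V (sqz K V) sqz_vec sqz_vec_is_additive.

Lemma sqz_scal_is_additive : additive sqz_scal.
Proof. by move=> u v; congr pair; rewrite subr0. Qed.

HB.instance Definition _ :=
  GRing.isAdditive.Build K (sqz K V) sqz_scal sqz_scal_is_additive.

Lemma sqz_scal_is_multiplicative : multiplicative sqz_scal.
Proof. by split=> // a b; congr pair; rewrite /= !scaler0 addr0. Qed.

HB.instance Definition _ :=
  GRing.isMultiplicative.Build K (sqz K V) sqz_scal sqz_scal_is_multiplicative.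

(** A linear identity between vectors becomes an identity in a commutative ring, where
    it can be decided by [ring]. *)
Lemma commutative_ring_embedding :
  exists (T : comNzRingType) (vec : {additive V -> T}) (scal : {rmorphism K -> T}),
    injective vec /\ forall a v, vec (a *: v) = scal a * vec v.
Proof.
exists (sqz K V), sqz_vec, sqz_scal; split; first by move=> u v [].
by move=> a v; congr pair; rewrite ?mulr0 //= scale0r addr0.
Qed.

End SquareZero.

(** Proves linear identities over [R[i]] in a module: products of the noncommutative
    algebra are atoms. *)
Ltac lin :=
  match goal with |- @eq ?V _ _ =>
    let T := fresh in let vec := fresh in let scal := fresh in
    let inj := fresh in let vecZ := fresh in
    have [T [vec [scal [inj vecZ]]]] := @commutative_ring_embedding _ V;
    apply: inj;
    rewrite ?(raddfD vec, raddfN vec, raddf0 vec, raddfMn vec, vecZ);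
    ring
  end.

(** * Arithmetic and norm of a C*-algebra *)

Section Algebra.
Context {R : realType} {A : cstarAlgType R}.
Implicit Types (x y z : A) (c : R[i]) (t : R).

Lemma mulZl c x y : (c *: x) * y = c *: (x * y).
Proof. by rewrite [RHS]cscaleAl. Qed.

Lemma mulZr c x y : x * (c *: y) = c *: (x * y).
Proof. by rewrite [RHS]cscaleAr. Qed.

Lemma starMr x y : star (x * y) = star y * star x.
Proof. exact: starM. Qed.

Lemma star0 : star 0 = 0 :> A.
Proof. by apply: (addrI (star 0)); rewrite -starD !addr0. Qed.

Lemma starN x : star (- x) = - star x.
Proof. by apply: (addrI (star x)); rewrite -starD !subrr star0. Qed.

Lemma star1 : star 1 = 1 :> A.
Proof. by rewrite -[LHS]mulr1 -{2}[1]starK -starMr mulr1 starK. Qed.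

Lemma star_sum (I : Type) (r : seq I) (P : pred I) (F : I -> A) :
  star (\sum_(i <- r | P i) F i) = \sum_(i <- r | P i) star (F i).
Proof. exact: (big_morph _ (@starD _ _) star0). Qed.

Lemma starZR t x : star (t%:C *: x) = t%:C *: star x.
Proof. by rewrite starZ conj_Creal // complex_real. Qed.

Lemma starZi x : star ('i *: x) = - 'i *: star x.
Proof. by rewrite starZ conjCi. Qed.

Lemma starZNi x : star (- 'i *: x) = 'i *: star x.
Proof. by rewrite !scaleNr starN starZi scaleNr opprK. Qed.

End Algebra.

(** Puts a noncommutative expression in the form expected by [lin], a linear
    combination of left-associated monomials. *)
Ltac expand := rewrite ?(mulrDl, mulrDr, mulNr, mulrN, mulZl, mulZr, mulrA,
  mul1r, mulr1, mul0r, mulr0, opprK).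

Section Norm.
Context {R : realType} {A : cstarAlgType R}.
Implicit Types (x y z : A) (c : R[i]) (t : R).

(** The norm of a complex module is [R[i]]-valued; real arithmetic needs it in [R]. *)
Definition nrm x : R := complex.Re `|x|.

Lemma nrmE x : `|x| = (nrm x)%:C.
Proof. by rewrite /nrm RRe_real // normr_real. Qed.

Lemma nrm_ge0 x : 0 <= nrm x.
Proof. by rewrite -lecR -nrmE normr_ge0. Qed.

Lemma nrmD x y : nrm (x + y) <= nrm x + nrm y.
Proof. by rewrite -lecR rmorphD /= -!nrmE ler_normD. Qed.

Lemma nrmN x : nrm (- x) = nrm x.
Proof. by rewrite /nrm normrN. Qed.

Lemma nrmB x y : nrm (x - y) = nrm (y - x).
Proof. by rewrite -nrmN opprB. Qed.

Lemma nrm_tri x y z : nrm (x - z) <= nrm (x - y) + nrm (y - z).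
Proof. by apply: le_trans (nrmD _ _); rewrite subrKA. Qed.

Lemma nrm0_eq0 x : nrm x = 0 -> x = 0.
Proof. by move=> x0; apply/eqP; rewrite -normr_eq0 nrmE x0. Qed.

Lemma nrm0 : nrm 0 = 0.
Proof. by rewrite /nrm normr0. Qed.

Lemma nrmZ c x : nrm (c *: x) = complex.Re `|c| * nrm x.
Proof.
apply: complexI; rewrite -nrmE normrZ nrmE rmorphM /=.
by rewrite RRe_real // normr_real.
Qed.

Lemma nrmZR t x : nrm (t%:C *: x) = `|t| * nrm x.
Proof. by rewrite nrmZ normc_def /= expr0n addr0 sqrtr_sqr. Qed.

Lemma nrmM x y : nrm (x * y) <= nrm x * nrm y.
Proof. by rewrite -lecR rmorphM /= -!nrmE; exact: cnormM_le. Qed.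

Lemma nrm_star_mul x : nrm (star x * x) = nrm x ^+ 2.
Proof. by apply: complexI; rewrite -nrmE rmorphXn /= -nrmE; exact: cstar_identity. Qed.

(** The C*-identity gives [|x|^2 <= |x^*| |x|], and the involution gives the converse. *)
Lemma nrm_star x : nrm (star x) = nrm x.
Proof.
suff le_star y : nrm y <= nrm (star y).
  by apply: le_anti; rewrite le_star -{2}[x]starK le_star.
have [->|y0] := eqVneq y 0; first by rewrite star0.
have ny : 0 < nrm y.
  by rewrite lt_def nrm_ge0 andbT; apply: contraNneq y0 => /nrm0_eq0 ->.
by rewrite -(ler_pM2r ny) -expr2 -nrm_star_mul nrmM.
Qed.

Lemma nrm1_le1 : nrm (1 : A) <= 1.
Proof.
have := nrm_star_mul (1 : A); rewrite star1 mulr1; have := nrm_ge0 (1 : A).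
by set n := nrm 1; nra.
Qed.

Lemma nrm_sa x : star x = x -> nrm (x * x) = nrm x ^+ 2.
Proof. by move=> sx; rewrite -nrm_star_mul sx. Qed.

Lemma nrmX x n : nrm (x ^+ n) <= nrm x ^+ n.
Proof.
elim: n => [|n IHn]; first by rewrite !expr0 nrm1_le1.
rewrite !exprS (le_trans (nrmM _ _)) // ler_wpM2l //; exact: nrm_ge0.
Qed.

Lemma starX x n : star (x ^+ n) = star x ^+ n.
Proof. by elim: n => [|n IHn]; rewrite ?star1 // exprS starMr IHn exprSr. Qed.

(** The C*-identity, iterated: on self-adjoint elements the norm is multiplicative along
    powers of two, a substitute for the spectral radius formula. *)
Lemma nrm_sa_pow2 x n : star x = x -> nrm (x ^+ (2 ^ n)) = nrm x ^+ (2 ^ n).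
Proof.
move=> sx; elim: n => [|n IHn]; first by rewrite !expr1.
rewrite expnSr !exprM -IHn [x ^+ _ ^+ 2]expr2 nrm_sa //.
by rewrite starX sx.
Qed.

(** A sequence whose steps are dominated by those of a bounded real sequence is Cauchy. *)
Lemma nrm_dominated_limit (u : nat -> A) (r : nat -> R) (M : R) :
    (forall n, nrm (u n.+1 - u n) <= r n.+1 - r n) -> (forall n, r n <= M) ->
  exists l, forall e, 0 < e -> exists N, forall n, (N <= n)%N -> nrm (u n - l) < e.
Proof.
move=> u_step r_le.
have u_dist n k : nrm (u (n + k)%N - u n) <= r (n + k)%N - r n.
  elim: k => [|k IHk]; first by rewrite addn0 !subrr nrm0.
  rewrite addnS (le_trans (nrm_tri _ (u (n + k)%N) _)) //.
  by have := u_step (n + k)%N; lra.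
have r_incr : nondecreasing_seq r.
  move=> m n /subnKC <-; rewrite -subr_ge0.
  exact: le_trans (nrm_ge0 _) (u_dist _ _).
have r_cvg : cvgn r.
  by apply: nondecreasing_is_cvgn => //; exists M => _ [n _ <-].
have r_le_L n : r n <= limn r by exact: nondecreasing_cvgn_le.
have /cvgrPdist_lt rL := r_cvg.
have : cvgn u.
  apply/cauchy_cvgP/cauchy_exP => e e0.
  have eR : e = (complex.Re e)%:C by rewrite RRe_real // gtr0_real.
  have e0' : 0 < complex.Re e by rewrite -ltcR -eR.
  have [N _ HN] := rL _ e0'.
  exists (u N); exists N => // n /= Nn; rewrite -ball_normE /= -normrN opprB nrmE eR ltcR.
  rewrite -(subnKC Nn); apply: le_lt_trans (u_dist _ _) _.
  have := HN N (leqnn N); rewrite ger0_norm ?subr_ge0 //=.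
  by have := r_le_L (N + (n - N))%N; lra.
case/cvg_ex => l /cvgrPdist_lt ul; exists l => e e0.
have [|N _ HN] := ul e%:C; first by rewrite ltcR.
by exists N => n Nn; rewrite -ltcR -nrmE -normrN opprB; exact: HN.
Qed.

End Norm.

Lemma continuous_nrm {R : realType} {A B : cstarAlgType R} (Phi : A -> B) :
    continuous Phi -> forall (x : A) (e : R), 0 < e ->
  exists2 d : R, 0 < d & forall y, nrm (x - y) < d -> nrm (Phi x - Phi y) < e.
Proof.
move=> Phi_cont x e e0.
have /cvgrPdist_lt /(_ e%:C) := Phi_cont x; rewrite ltcR => /(_ e0).
case/nbhs_normP => d /= d0 Hd.
have dR : d = (complex.Re d)%:C by rewrite RRe_real // gtr0_real.
exists (complex.Re d); first by rewrite -ltcR -dR.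
move=> y xy; rewrite -ltcR -nrmE; apply: Hd => /=.
by rewrite dR nrmE ltcR.
Qed.

(** * Square roots and the positive cone *)

Lemma le_small {R : realType} (K a b : R) :
  (forall e : R, 0 < e -> a <= b + K * e) -> a <= b.
Proof.
move=> H; apply/ler_addgt0Pr => e e0.
have K0 : 0 < `|K| + 1 by rewrite ltr_wpDl.
apply: (le_trans (H (e / (`|K| + 1)) _)); first exact: divr_gt0.
rewrite lerD2l mulrCA ger_pMr // ler_pdivrMr // mul1r.
by rewrite (le_trans (ler_norm K)) // lerDl.
Qed.

Section Cone.
Context {R : realType} {A : cstarAlgType R}.
Implicit Types (x y z h k l c : A) (t e : R).

Lemma nrm_le0 x : nrm x <= 0 -> x = 0.
Proof. by move=> x0; apply/nrm0_eq0/le_anti; rewrite x0 nrm_ge0. Qed.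

(** The iteration [y := (x + y^2) / 2] started at 0 converges to [1 - sqrt (1 - x)].  Its
    terms commute, so [y_(n+2) - y_(n+1)] is half the product of [y_(n+1) - y_n] and
    [y_(n+1) + y_n]: the norms are dominated by the same iteration for the real number
    [x = 1], which increases and stays below 1. *)
Lemma sqrt_one_sub x : star x = x -> nrm x <= 1 ->
  exists s, [/\ star s = s, s * s = 1 - x, nrm (1 - s) <= 1 &
    forall c, c * x = x * c -> c * s = s * c].
Proof.
move=> sx x1.
have [y [y0 yS]] : exists y : nat -> A,
    y 0%N = 0 /\ forall n, y n.+1 = 2^-1%:C *: (x + y n * y n).
  by exists (fix y n := if n is m.+1 then 2^-1%:C *: (x + y m * y m) else 0).
have [r [r0 rS]] : exists r : nat -> R,
    r 0%N = 0 /\ forall n, r n.+1 = 2^-1 * (1 + r n * r n).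
  by exists (fix r n := if n is m.+1 then 2^-1 * (1 + r m * r m) else 0).
have r01 n : 0 <= r n <= 1 by elim: n => [|n IHn]; rewrite ?r0 ?rS; [lra | nra].
have y_sa n : star (y n) = y n.
  by elim: n => [|n IHn]; rewrite ?y0 ?star0 // yS starZR starD starMr IHn sx.
have y_comm n c : c * x = x * c -> c * y n = y n * c.
  move=> cx; elim: n => [|n IHn]; rewrite ?y0 ?yS; first by rewrite mulr0 mul0r.
  by rewrite mulZl mulZr mulrDl mulrDr cx mulrA IHn -!mulrA IHn.
have yy m n : y m * y n = y n * y m by exact: (y_comm _ _ (esym (y_comm _ _ erefl))).
have y_le n : nrm (y n) <= r n.
  elim: n => [|n IHn]; rewrite ?y0 ?yS ?r0 ?rS; first by rewrite nrm0.
  rewrite nrmZR ger0_norm ?invr_ge0 // ler_wpM2l ?invr_ge0 //.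
  rewrite (le_trans (nrmD _ _)) // lerD // (le_trans (nrmM _ _)) //.
  by apply: ler_pM; rewrite ?nrm_ge0.
have y_step n : nrm (y n.+1 - y n) <= r n.+1 - r n.
  elim: n => [|n IHn].
    rewrite yS rS y0 r0 !mulr0 !addr0 !subr0 nrmZR.
    by rewrite ger0_norm ?invr_ge0 // ler_wpM2l ?invr_ge0.
  have -> : y n.+2 - y n.+1 = 2^-1%:C *: ((y n.+1 - y n) * (y n.+1 + y n)).
    rewrite (yS n.+1) [X in _ - X = _]yS; expand; rewrite (yy n.+1 n).
    by move: (y n.+1) => y'; lin.
  have -> : r n.+2 - r n.+1 = 2^-1 * ((r n.+1 - r n) * (r n.+1 + r n)).
    by rewrite (rS n.+1) [X in _ - X = _]rS; ring.
  rewrite nrmZR ger0_norm ?invr_ge0 // ler_wpM2l ?invr_ge0 //.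
  rewrite (le_trans (nrmM _ _)) //; apply: ler_pM; rewrite ?nrm_ge0 //.
  exact: le_trans (nrmD _ _) (lerD (y_le _) (y_le _)).
have y1 n : nrm (y n) <= 1 by case/andP: (r01 n) => _; apply: le_trans.
have [|l yl] := @nrm_dominated_limit _ _ y r 1 y_step; first by move=> n; case/andP: (r01 n).
have l_sa : star l = l.
  apply/eqP; rewrite -subr_eq0; apply/eqP/nrm_le0/(@le_small _ 2) => e /yl[N /(_ N (leqnn N)) yN].
  rewrite add0r (le_trans (nrm_tri _ (y N) _)) // -{1}[y N]y_sa -starN -starD nrm_star.
  by rewrite (nrmB l); lra.
have l_comm c : c * x = x * c -> c * l = l * c.
  move=> cx; apply/eqP; rewrite -subr_eq0; apply/eqP/nrm_le0.
  apply/(@le_small _ (2 * nrm c)) => e /yl[N /(_ N (leqnn N)) yN].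
  have -> : c * l - l * c = c * (l - y N) + (y N - l) * c.
    by expand; rewrite (y_comm N c cx); lin.
  rewrite add0r (le_trans (nrmD _ _)) //.
  have := nrmM c (l - y N); have := nrmM (y N - l) c; rewrite (nrmB l).
  by have := nrm_ge0 c; nra.
have l1 : nrm l <= 1.
  apply/(@le_small _ 1) => e /yl[N /(_ N (leqnn N)) yN].
  have := nrmD (l - y N) (y N); rewrite subrK (nrmB l).
  by have := y1 N; lra.
have leq : l *+ 2 = x + l * l.
  apply/eqP; rewrite -subr_eq0; apply/eqP/nrm_le0/(@le_small _ 4) => e /yl[N yN].
  have -> : l *+ 2 - (x + l * l) = (l - y N.+1) + (l - y N.+1)
      + ((y N - l) * y N + l * (y N - l)).
    have -> : x = y N.+1 *+ 2 - y N * y N.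
      rewrite yS -scaler_nat scalerA.
      rewrite (_ : 2%:R * _ = 1 :> R[i]) ?scale1r ?addrK //.
      by rewrite fmorphV /= rmorph_nat divff // pnatr_eq0.
    by move: (y N.+1) => y'; expand; lin.
  have := yN N (leqnn N); have := yN N.+1 (leqnSn N).
  rewrite add0r => e1 e2; apply: le_trans (nrmD _ _) _.
  have := nrmD (l - y N.+1) (l - y N.+1).
  have := nrmD ((y N - l) * y N) (l * (y N - l)).
  have := nrmM (y N - l) (y N); have := nrmM l (y N - l).
  rewrite (nrmB l (y N.+1)); have := y1 N.
  by have := nrm_ge0 (y N - l); nra.
exists (1 - l); split.
- by rewrite starD starN star1 l_sa.
- by expand; have -> : x = l *+ 2 - l * l; [rewrite leq addrK | lin].
- by rewrite opprB addrC subrK.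
- by move=> c cx; expand; rewrite l_comm.
Qed.

(** For self-adjoint elements this is positivity of the spectrum, since [|t - h| <= t]
    says that the spectrum of [h] lies in [[0, 2t]].  In this form the cone axioms are
    triangle inequalities. *)
Definition nneg h : Prop :=
  star h = h /\ exists2 t, 0 <= t & nrm (t%:C *: (1 : A) - h) <= t.

Lemma nneg_sa h : nneg h -> star h = h. Proof. by case. Qed.

Lemma nrm_scal t : 0 <= t -> nrm (t%:C *: (1 : A)) <= t.
Proof.
move=> t0; rewrite nrmZR ger0_norm // ler_piMr //; exact: nrm1_le1.
Qed.

Lemma nneg0 : nneg 0.
Proof. by split; [exact: star0 | exists 0; rewrite // scale0r subr0 nrm0]. Qed.

Lemma nnegD h k : nneg h -> nneg k -> nneg (h + k).
Proof.
move=> [sh [t t0 ht]] [sk [s s0 ks]]; split; first by rewrite starD sh sk.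
exists (t + s); first exact: addr_ge0.
have -> : (t + s)%:C *: (1 : A) - (h + k) = (t%:C *: (1 : A) - h) + (s%:C *: (1 : A) - k).
  by rewrite rmorphD /= scalerDl; lin.
exact: le_trans (nrmD _ _) (lerD ht ks).
Qed.

Lemma nneg_sum (I : Type) (r : seq I) (F : I -> A) :
  (forall i, nneg (F i)) -> nneg (\sum_(i <- r) F i).
Proof. by move=> F0; elim/big_ind: _ => //; [exact: nneg0 | exact: nnegD]. Qed.

Lemma nnegZ t h : 0 <= t -> nneg h -> nneg (t%:C *: h).
Proof.
move=> t0 [sh [s s0 hs]]; split; first by rewrite starZR sh.
exists (t * s); first exact: mulr_ge0.
by rewrite rmorphM /= -scalerA -scalerBr nrmZR ger0_norm // ler_wpM2l.
Qed.

Lemma nneg_sqrt h : nneg h ->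
  exists r, [/\ nneg r, r * r = h & forall c, c * h = h * c -> c * r = r * c].
Proof.
move=> [sh [t t0 ht]]; have [tz|tn0] := eqVneq t 0.
  have -> : h = 0.
    by apply/nrm_le0; rewrite -nrmN; move: ht; rewrite tz scale0r sub0r.
  by exists 0; split=> [||c _]; rewrite ?mul0r ?mulr0 //; exact: nneg0.
have tp : 0 < t by rewrite lt_def tn0.
have tK : t%:C * t^-1%:C = 1 by rewrite fmorphV /= divff // fmorph_eq0.
have [||s [ss s2 s1 sc]] := @sqrt_one_sub (1 - t^-1%:C *: h).
- by rewrite starD starN star1 starZR sh.
- have -> : 1 - t^-1%:C *: h = t^-1%:C *: (t%:C *: (1 : A) - h).
    by rewrite scalerBr scalerA mulrC tK scale1r.
  by rewrite nrmZR ger0_norm ?invr_ge0 // mulrC ler_pdivrMr // mul1r.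
have q0 : 0 <= Num.sqrt t by exact: sqrtr_ge0.
have qq : (Num.sqrt t)%:C * (Num.sqrt t)%:C = t%:C.
  by rewrite -rmorphM /= -expr2 sqr_sqrtr.
exists ((Num.sqrt t)%:C *: s); split.
- split; first by rewrite starZR ss.
  by exists (Num.sqrt t) => //; rewrite -scalerBr nrmZR ger0_norm // ler_piMr.
- by rewrite mulZl mulZr scalerA qq s2 opprB addrC subrK scalerA tK scale1r.
- move=> c ch; rewrite mulZl mulZr sc //.
  by rewrite mulrDl mulrDr mulNr mulrN mulZl mulZr ch mul1r mulr1.
Qed.

(** With [z = k + i l], commutation gives [z^* z = k^2 + l^2], while [2 k = z + z^*] has
    norm at most [2 |z|]. *)
Lemma nrm_sqr_le_sum k l : star k = k -> star l = l -> k * l = l * k ->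
  nrm (k * k) <= nrm (k * k + l * l).
Proof.
move=> sk sl kl; pose z := k + 'i *: l.
have -> : k * k + l * l = star z * z.
  rewrite /z starD starZi sk sl; expand; rewrite kl scalerA mulNr mulCii opprK scale1r.
  by lin.
rewrite nrm_sa // nrm_star_mul ler_pXn2r ?nnegrE ?nrm_ge0 //.
have : nrm (k *+ 2) <= nrm z *+ 2.
  have -> : k *+ 2 = z + star z by rewrite /z starD starZi sk sl; lin.
  by rewrite mulr2n -{2}(nrm_star z) nrmD.
have -> : k *+ 2 = 2%:C *: k by rewrite -scaler_nat rmorph_nat.
by rewrite nrmZR ger0_norm //; lra.
Qed.

(** If [|k| <= 1], then [1 - k^2] has a square root [s] commuting with [k], and
    [|1 - k^2| = |s^2| <= |s^2 + k^2| <= 1].  The general case follows by scaling. *)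
Lemma nneg_sqr k : star k = k -> nneg (k * k).
Proof.
have unit_case l : star l = l -> nrm l <= 1 -> nneg (l * l).
  move=> sl l1; split; first by rewrite starMr sl.
  exists 1 => //; rewrite scale1r.
  have [||s [ss s2 _ sc]] := @sqrt_one_sub (l * l); first by rewrite starMr sl.
    by rewrite nrm_sa // expr_le1 // nrm_ge0.
  have sl' : s * l = l * s by rewrite sc // mulrA.
  rewrite -s2 (le_trans (nrm_sqr_le_sum s l ss sl sl')) // s2 subrK; exact: nrm1_le1.
move=> sk; have [k1|k1] := leP (nrm k) 1; first exact: unit_case.
have kp : 0 < nrm k by lra.
have kn0 : (nrm k)%:C != 0 by rewrite fmorph_eq0 gt_eqF.
have -> : k * k = (nrm k ^+ 2)%:C *: (((nrm k)^-1%:C *: k) * ((nrm k)^-1%:C *: k)).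
  rewrite mulZl mulZr !scalerA rmorphXn fmorphV /=.
  by rewrite (_ : _ * _ = 1 :> R[i]) ?scale1r //; field.
apply: nnegZ; first exact: sqr_ge0.
apply: unit_case; first by rewrite starZR sk.
by rewrite nrmZR ger0_norm ?invr_ge0 ?nrm_ge0 // mulVf // gt_eqF.
Qed.

(** The square roots [r] of [h] and [q] of [- h] commute, and [r^2 + q^2 = 0]. *)
Lemma nneg_anti h : nneg h -> nneg (- h) -> h = 0.
Proof.
move=> h0 hN0; have [r [/nneg_sa sr rh _]] := nneg_sqrt _ h0.
have [q [/nneg_sa sq qh qc]] := nneg_sqrt _ hN0.
have rq : r * q = q * r by apply: qc; rewrite mulrN mulNr -rh mulrA.
apply: nrm_le0; rewrite -rh; apply: le_trans (nrm_sqr_le_sum _ _ sr sq rq) _.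
by rewrite rh qh subrr nrm0.
Qed.

(** The radius [t] in the definition of [nneg] can be any bound of the norm: both [h] and
    [t - h] are squares of commuting elements, and their sum is [t]. *)
Lemma nneg_bound h t : nneg h -> nrm h <= t -> nrm (t%:C *: (1 : A) - h) <= t.
Proof.
move=> h0 ht; have t0 : 0 <= t by apply: le_trans ht; exact: nrm_ge0.
have k0 : nneg (t%:C *: (1 : A) - h).
  split; first by rewrite starD starN starZR star1 nneg_sa.
  by exists t => //; rewrite opprB addrC subrK.
have [r [/nneg_sa sr rh _]] := nneg_sqrt _ h0.
have [q [/nneg_sa sq qh qc]] := nneg_sqrt _ k0.
have rq : q * r = r * q.
  by apply/esym/qc; rewrite -rh; expand.
rewrite -qh; apply: le_trans (nrm_sqr_le_sum _ _ sq sr rq) _.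
by rewrite rh qh subrK nrm_scal.
Qed.

(** By [nneg_bound] one radius serves for all approximants. *)
Lemma nneg_closed h :
  (forall e, 0 < e -> exists2 k, nneg k & nrm (h - k) <= e) -> nneg h.
Proof.
move=> H; split.
  apply/eqP; rewrite -subr_eq0; apply/eqP/nrm_le0/(@le_small _ 2) => e /H[k k0 hk].
  rewrite add0r (le_trans (nrm_tri _ k _)) // -{1}(nneg_sa _ k0) -starN -starD nrm_star.
  by rewrite (nrmB k); lra.
exists (nrm h + 1); first by rewrite addr_ge0 // nrm_ge0.
apply: (@le_small _ 1) => e e0.
have [|k k0 hk] := H (Num.min e 1); first by rewrite lt_min e0 ltr01.
move: hk; rewrite le_min => /andP[hke hk1].
have kh : nrm k <= nrm h + 1.
  by rewrite -[k](subrK h) (le_trans (nrmD _ _)) // nrmB; lra.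
rewrite (le_trans (nrm_tri _ k _)) // (nrmB k).
by have := nneg_bound _ _ k0 kh; lra.
Qed.

End Cone.

(** * Elements of the form [star z * z] *)

(** If [v = t (1 + d)] with [d > 0], the square of Bernoulli's inequality bounds
    [(v / t)^(2^(k+1))] below by a quadratic polynomial in [2^k]. *)
Lemma pow_growth_le {R : realType} (t v : R) : 0 < t ->
  (forall k : nat, v ^+ (2 ^ k) <= t ^+ (2 ^ k) * (1 + (2 ^ k)%:R)) -> v <= t.
Proof.
move=> t0 H; rewrite leNgt; apply/negP => tv.
pose d := v / t - 1.
have d0 : 0 < d by rewrite subr_gt0 ltr_pdivlMr ?mul1r.
have Bern n : 1 + n%:R * d <= (1 + d) ^+ n.
  elim: n => [|n IHn]; first by rewrite mul0r addr0 expr0.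
  rewrite exprS -natr1; have := ler0n R n; nra.
have {}H (k : nat) : (1 + d) ^+ (2 ^ k) <= 1 + (2 ^ k)%:R.
  by rewrite /d addrC subrK expr_div_n ler_pdivrMr ?exprn_gt0 // mulrC H.
have K (k : nat) : k%:R * d ^+ 2 <= 2.
  have := H k.+1; rewrite expnSr exprM; set w := (1 + d) ^+ _ => Hw.
  have := Bern (2 ^ k)%N; rewrite -/w.
  have : k%:R <= (2 ^ k)%:R :> R by rewrite ler_nat ltnW // ltn_expl.
  have np : 0 < (2 ^ k)%:R :> R by rewrite ltr0n expn_gt0.
  move: Hw; rewrite natrM; set m := (2 ^ k)%:R in np * => Hw km Bm.
  have md : 0 < m * d by rewrite mulr_gt0.
  have ww : (1 + m * d) * (1 + m * d) <= w ^+ 2 by rewrite expr2; apply: ler_pM; lra.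
  apply: (@le_trans _ _ (m * d ^+ 2)); first by rewrite ler_wpM2r // sqr_ge0.
  by rewrite -(ler_pM2l np); lra.
have d2 : 0 < d ^+ 2 by rewrite exprn_gt0.
pose n := (Num.trunc (2 / d ^+ 2)).+1.
have : 2 / d ^+ 2 < n%:R by exact: truncnS_gt.
by rewrite ltr_pdivrMr // ltNge K.
Qed.

Section Kaplansky.
Context {R : realType} {A : cstarAlgType R}.
Implicit Types (x y z h k : A) (t : R).

Lemma scale_halfK x : 2^-1%:C *: (x *+ 2) = x.
Proof.
by rewrite -[x *+ 2]scaler_nat scalerA fmorphV /= rmorph_nat mulVf ?scale1r.
Qed.

(** The spectra of [y^* y] and [y y^*] agree up to 0.  Concretely, with [u = t + y^* y] and
    [v = t + y y^*] one has [v y = y u], so [v^(n+1) = t v^n + y u^n y^*].  As [|u| <= t],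
    the norm of [v^n] is at most [t^n (1 + n)], and [|v| <= t] follows along powers of 2. *)
Lemma nneg_opp_swap y : nneg (- (star y * y)) -> nneg (- (y * star y)).
Proof.
move=> y0; split; first by rewrite starN starMr starK.
pose t := nrm y ^+ 2 + 1.
have tp : 0 < t by rewrite ltr_wpDl ?sqr_ge0.
exists t; first exact: ltW.
rewrite opprK.
pose u := t%:C *: (1 : A) + star y * y; pose v := t%:C *: (1 : A) + y * star y.
have u_le : nrm u <= t.
  have := nneg_bound _ t y0; rewrite opprK nrmN nrm_star_mul; apply.
  by rewrite /t lerDl.
have vy n : v ^+ n * y = y * u ^+ n.
  elim: n => [|n IHn]; first by rewrite mul1r mulr1.
  rewrite exprSr -mulrA (_ : v * y = y * u) ?mulrA ?IHn -?mulrA -?exprS ?exprSr //.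
  by rewrite /u /v; expand.
have v_sa : star v = v by rewrite /v starD starZR star1 starMr starK.
have v_le n : nrm (v ^+ n) <= t ^+ n * (1 + n%:R).
  elim: n => [|n IHn]; first by rewrite !expr0 mul1r addr0 nrm1_le1.
  have -> : v ^+ n.+1 = t%:C *: v ^+ n + y * u ^+ n * star y.
    by rewrite exprSr -vy {2}/v; expand.
  rewrite (le_trans (nrmD _ _)) // nrmZR gtr0_norm // exprS -natr1.
  have un : nrm (u ^+ n) <= t ^+ n.
    by rewrite (le_trans (nrmX _ _)) // lerXn2r ?nnegrE ?nrm_ge0 // ltW.
  have : nrm (y * u ^+ n * star y) <= nrm y ^+ 2 * t ^+ n.
    rewrite (le_trans (nrmM _ _)) // nrm_star mulrC expr2 -mulrA.
    rewrite ler_wpM2l ?nrm_ge0 // (le_trans (nrmM _ _)) //.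
    by rewrite ler_wpM2l ?nrm_ge0.
  have tn : 0 <= t ^+ n by rewrite exprn_ge0 // ltW.
  have : nrm y ^+ 2 <= t by rewrite /t lerDl.
  have : t * nrm (v ^+ n) <= t * (t ^+ n * (1 + n%:R)) by rewrite ler_pM2l.
  nra.
apply: (@pow_growth_le _ t) => // k.
by rewrite -nrm_sa_pow2.
Qed.

(** Kaplansky's argument.  Let [a = z^* z], [b = sqrt (a^2)] and [m = b - a], twice the
    negative part of [a]; then [m a = - m b].  For [y = z m] this makes
    [- y^* y = m b m] a square, so [- y y^*] is nonnegative too.  But
    [y y^* + y^* y] is half a sum of squares, so [y y^*] is nonnegative as well, whence
    [y = 0], then [m^4 = 0] and [a = b]. *)
Lemma star_mul_nneg z : nneg (star z * z).
Proof.
have [a def_a] : exists a, a = star z * z by exists (star z * z).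
have sa : star a = a by rewrite def_a starMr starK.
rewrite -def_a.
have [b [b0 ba bc]] := nneg_sqrt _ (nneg_sqr a sa).
have [s [/nneg_sa ss sb sc]] := nneg_sqrt _ b0.
have sb' := nneg_sa _ b0.
have ab : a * b = b * a by apply: bc; rewrite mulrA.
have as' : a * s = s * a by exact: sc.
have bs : b * s = s * b by exact: sc.
have [m def_m] : exists m, m = b - a by exists (b - a).
have sm : star m = m by rewrite def_m starD starN sa sb'.
have ma : m * a = - (m * b).
  by rewrite def_m; expand; rewrite ba ab; lin.
have ms : m * s = s * m by rewrite def_m; expand; rewrite as' bs.
have [y def_y] : exists y, y = z * m by exists (z * m).
have yy : - (star y * y) = (m * s) * (m * s).
  rewrite def_y starMr sm -mulrA (mulrA (star z)) -def_a mulrA ma mulNr opprK.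
  by rewrite -sb (mulrA m s) -!mulrA -ms.
have y1 : nneg (- (star y * y)).
  by rewrite yy; apply: nneg_sqr; rewrite starMr sm ss.
have y2 := nneg_opp_swap _ y1.
have y3 : nneg (y * star y).
  have -> : y * star y = 2^-1%:C *: ((y + star y) * (y + star y)
      + ('i *: (y - star y)) * ('i *: (y - star y))) + (- (star y * y)).
    rewrite mulZl mulZr scalerA mulCii scaleN1r.
    rewrite (_ : (y + star y) * _ + _ = (y * star y + star y * y) *+ 2); last by expand; lin.
    by rewrite scale_halfK addrK.
  apply: nnegD y1; apply: nnegZ; first by rewrite invr_ge0.
  apply: nnegD; apply: nneg_sqr; first by rewrite starD starK addrC.
  by rewrite starZi starD starN starK scaleNr -scalerN opprB.
have sy0 : star y = 0.
  apply/nrm0_eq0/eqP; rewrite -sqrf_eq0 -nrm_star_mul starK.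
  by rewrite (nneg_anti _ y3 y2) nrm0.
have mam : m * a * m = 0.
  transitivity (star y * y); last by rewrite sy0 mul0r.
  by rewrite {2}def_y mulrA def_y starMr sm def_a !mulrA.
(* [m^3 = m b m - m a m], and both terms vanish with [y^* y]. *)
have mbm : m * b * m = 0 by rewrite -[m * b]opprK -ma mulNr mam oppr0.
have m0 : m = 0.
  suff : nrm m ^+ 4 == 0 by rewrite expf_eq0 => /= /eqP/nrm0_eq0.
  rewrite (_ : nrm m ^+ 4 = nrm (m ^+ (2 ^ 2))); last by rewrite nrm_sa_pow2.
  rewrite (_ : m ^+ (2 ^ 2) = (m * b * m - m * a * m) * m); last first.
    by rewrite !exprS expr0 mulr1 {2}def_m; expand.
  by rewrite mam mbm subrr mul0r nrm0.
by rewrite (_ : a = b) //; apply/esym/eqP; rewrite -subr_eq0 -def_m m0.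
Qed.

End Kaplansky.

(** * Gram matrices and entrywise maps *)

Section GramForms.
Context {R : realType}.
Implicit Types A B : cstarAlgType R.

(** For [M = Y^* Y] the form is the sum of [w_l^* w_l], where [w = Y k]. *)
Lemma mx_pos_form B n (M : 'M[B]_n) (k : 'I_n -> B) : mx_pos M ->
  nneg (\sum_i \sum_j star (k i) * M i j * k j).
Proof.
case=> Y ->; pose w l := \sum_j Y l j * k j.
suff -> : \sum_i \sum_j star (k i) * (mxstar Y *m Y) i j * k j
    = \sum_l star (w l) * w l by apply: nneg_sum => l; exact: star_mul_nneg.
under eq_bigr => i _ do under eq_bigr => j _ do
  (rewrite !mxE mulr_sumr mulr_suml;
   under eq_bigr => l _ do rewrite !mxE).
under [RHS]eq_bigr => l _ do (rewrite star_sum mulr_suml;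
   under eq_bigr => i _ do rewrite starMr mulr_sumr).
rewrite [RHS]exchange_big; apply: eq_bigr => i _.
rewrite exchange_big; apply: eq_bigr => l _.
by apply: eq_bigr => j _; rewrite !mulrA.
Qed.

(** Row [l] of the factor has entries [v l 0, v l 1, ...]; indexing by [nat] lets concrete
    rows be given as lists. *)
Definition gram {A} m (v : nat -> nat -> A) (i j : nat) : A :=
  \sum_(l < m) star (v l i) * v l j.

Definition gram_mx {A} n m (v : nat -> nat -> A) : 'M[A]_n :=
  \matrix_(i, j) gram m v i j.

(** The factor must be square: the [m] rows are completed by zero rows, which is why a
    Gram matrix of size [n] is only used with [m <= n] rows. *)
Lemma gram_mx_pos A n m (v : nat -> nat -> A) : (m <= n)%N ->
  mx_pos (gram_mx n m v).
Proof.
move=> mn; exists (\matrix_(l, j) if (l < m)%N then v l j else 0).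
apply/matrixP => i j; rewrite !mxE /gram.
rewrite (big_ord_widen n (fun l => star (v l i) * v l j) mn) big_mkcond /=.
by apply: eq_bigr => l _; rewrite !mxE; case: ifP; rewrite // mulr0.
Qed.

(** Unlike [n_positive], this property passes to smaller sizes by setting coefficients
    of the form to 0, without extracting a square root of a corner. *)
Definition gram_positive n {A B} (Phi : A -> B) : Prop :=
  forall m (v : nat -> nat -> A) (k : nat -> B), (m <= n)%N ->
  nneg (\sum_(i < n) \sum_(j < n) star (k i) * Phi (gram m v i j) * k j).

Lemma n_positive_gram A B (Phi : A -> B) N n : n_positive N Phi ->
  (n <= N)%N -> gram_positive n Phi.
Proof.
move=> PhiN nN m v k mn; pose k' i := if (i < n)%N then k i else 0.
have mN := leq_trans mn nN.
have := mx_pos_form _ _ _ (fun i : 'I_N => k' i) (PhiN _ (gram_mx_pos _ N m v mN)).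
congr nneg.
rewrite (big_ord_widen N (fun i => \sum_(j < n) star (k i) * Phi (gram m v i j) * k j) nN).
rewrite [RHS]big_mkcond; apply: eq_bigr => i _; rewrite /k'; case: ifP => _; last first.
  by rewrite big1 // => j _; rewrite star0 !mul0r.
rewrite (big_ord_widen N (fun j => star (k i) * Phi (gram m v i j) * k j) nN).
rewrite [RHS]big_mkcond; apply: eq_bigr => j _.
by rewrite !mxE; case: ifP; rewrite // mulr0.
Qed.

Lemma Smon_form A B (Phi : A -> B) n (v w : nat -> nat -> A) m1 m2
    (k : nat -> B) : Smon_plus n Phi -> (m1 <= n)%N -> (m2 <= n)%N ->
  nneg (\sum_(i < n) \sum_(j < n) star (k i) *
    (Phi (gram m1 v i j + gram m2 w i j) - Phi (gram m2 w i j)) * k j).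
Proof.
move=> [_ mono] m1n m2n.
have := mono (gram_mx n m1 v + gram_mx n m2 w) (gram_mx n m2 w).
rewrite /mx_ge addrK subr0 => /(_ (gram_mx_pos _ _ _ _ m1n) (gram_mx_pos _ _ _ _ m2n)).
move/(mx_pos_form _ _ _ (fun i : 'I_n => k i)); congr nneg.
by apply: eq_bigr => i _; apply: eq_bigr => j _; rewrite !mxE.
Qed.

Lemma Smon_n_positive A B (Phi : A -> B) n : Phi 0 = 0 -> Smon_plus n Phi ->
  n_positive n Phi.
Proof.
move=> Phi0 [_ mono] X X0; have := mono X 0; rewrite /mx_ge !subr0.
have z0 : mx_pos (0 : 'M[A]_n) by exists 0; rewrite mulmx0.
move=> /(_ X0 z0); congr mx_pos; apply/matrixP => i j.
by rewrite !mxE Phi0 subr0.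
Qed.

End GramForms.

Definition row4 {T : zmodType} (a b c d : T) (i : nat) : T :=
  nth 0 [:: a; b; c; d] i.

Ltac unfold_form := rewrite /gram /row4 !big_ord_recl !big_ord0 /=
  ?(star0, star1, starN, starD, starMr, starK, mul0r, mulr0, mul1r, mulr1, addr0, add0r,
    mulrN1, mulN1r, opprK).

(** * Consequences of 4-positivity *)

Section Positive4.
Context {R : realType} {A B : cstarAlgType R} (Phi : A -> B).
Hypotheses (Phi0 : Phi 0 = 0) (Phi1 : Phi 1 = 1) (Phi4 : gram_positive 4 Phi).
Implicit Types (x y a b c : A) (p : B) (t : R).

(** The Gram matrix has entries [P + Q [i,j<2] + S [i,j even]], and the signs
    [(1, -1, -1, 1)] extract the second difference. *)
Lemma strongly_superadditive a b c :
  let P := star a * a in let Q := star b * b in let S := star c * c in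
  nneg (Phi (P + Q + S) - Phi (P + Q) - Phi (P + S) + Phi P).
Proof.
move=> P Q S.
pose v := nth (row4 0 0 0 0) [:: row4 a a a a; row4 b b 0 0; row4 c 0 c 0].
have := Phi4 3 v (row4 1 (-1) (-1) 1) isT.
congr nneg; rewrite /v; unfold_form; rewrite !addrA -/P -/Q -/S.
by lin.
Qed.

Lemma superadditive b c :
  nneg (Phi (star b * b + star c * c) - Phi (star b * b) - Phi (star c * c)).
Proof.
have /= := strongly_superadditive 0 b c.
by rewrite star0 mul0r !add0r Phi0 addr0.
Qed.

(** The form of the matrix with rows [1, Phi x] and [Phi (x^* ), Phi (x^* x)] is
    self-adjoint for the coefficients [(1, 1)] and [(i, 1)]; this is polarization. *)
Lemma positive_star x : Phi (star x) = star (Phi x).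
Proof.
have form p : nneg (star p * p + star p * Phi x + Phi (star x) * p + Phi (star x * x)).
  pose v := nth (row4 0 0 0 0) [:: row4 1 x 0 0].
  have := Phi4 1 v (row4 p 1 0 0) isT.
  by congr nneg; rewrite /v; unfold_form; rewrite Phi1; expand; lin.
have diag : star (Phi (star x * x)) = Phi (star x * x).
  apply: nneg_sa; have := form 0; rewrite star0 !mul0r mulr0 !add0r.
  exact.
have {diag} sa p : star (star p * Phi x + Phi (star x) * p)
    = star p * Phi x + Phi (star x) * p.
  have := nneg_sa _ (form p).
  rewrite -!addrA (addrA (_ * Phi x)) 2!starD [star (star p * p)]starMr starK.
  by rewrite diag => /addrI/addIr.
have e1 := sa 1; have e2 := sa ('i *: (1 : B)).
move: e1 e2; rewrite !starD !starMr !starZi !starZNi !starK star1; expand.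
move: (Phi (star x)) (Phi x) => u v e1 e2.
have e3 : star v - star u = u - v.
  have := congr1 (fun z : B => - 'i *: z) e2.
  rewrite !scalerDr !scalerA mulrN !mulNr mulCii !opprK !scale1r !scaleN1r.
  by rewrite [- v + u]addrC.
rewrite -[u]scale_halfK -[star v]scale_halfK; congr (_ *: _).
have -> : u *+ 2 = (v + u) + (u - v) by lin.
by rewrite -e1 -e3; lin.
Qed.

(** The Gram matrix of the row [(1, x, y)] has corner [Phi 1 = 1]; the first coefficient
    of the form is chosen so as to eliminate that corner. *)
Lemma schur_form x y p : nneg (
    star p * (Phi (star x * x) - star (Phi x) * Phi x) * p
  + star p * (Phi (star x * y) - star (Phi x) * Phi y)
  + star (Phi (star x * y) - star (Phi x) * Phi y) * p
  + (Phi (star y * y) - star (Phi y) * Phi y)).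
Proof.
pose v := nth (row4 0 0 0 0) [:: row4 1 x y 0].
pose w := - (Phi x * p + Phi y).
have := Phi4 1 v (row4 w p 1 0) isT.
congr nneg; rewrite /v; unfold_form; rewrite Phi1 !positive_star /w.
rewrite -(positive_star (star x * y)) !starMr !starK.
rewrite ?(starN, starD, starMr, starK, mulr1).
expand; rewrite ?positive_star.
lin.
Qed.

Lemma schwarz x : nneg (Phi (star x * x) - star (Phi x) * Phi x).
Proof.
have := schur_form 0 x 0.
by rewrite !star0 !mul0r !mulr0 !add0r.
Qed.

End Positive4.

Section Corner.
Context {R : realType} {B : cstarAlgType R}.
Implicit Types (E F p : B) (t : R).

(** A positive 2x2 matrix with a zero diagonal entry has zero off-diagonal entry: with
    [p = - t E] the form is [F - 2 t E^* E], and dividing by [2 t] with [t] large shows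
    that [- E^* E] is nonnegative. *)
Lemma corner_eq0 E F :
  (forall p, nneg (star p * E + star E * p + F)) -> E = 0.
Proof.
move=> H.
suff : nneg (- (star E * E)).
  move=> /(nneg_anti _ (star_mul_nneg E)) EE0.
  by apply/nrm0_eq0/eqP; rewrite -sqrf_eq0 -nrm_star_mul EE0 nrm0.
apply: nneg_closed => e e0.
pose t := (nrm F + 1) / e.
have F1 : 0 < nrm F + 1 by rewrite ltr_wpDl ?nrm_ge0.
have t0 : 0 < t by rewrite divr_gt0.
have c0 : 0 < 2 * t by rewrite mulr_gt0.
exists ((2 * t)^-1%:C *: (star (- t%:C *: E) * E + star E * (- t%:C *: E) + F)).
  by apply: nnegZ; [rewrite invr_ge0 ltW | exact: H].
have -> : star (- t%:C *: E) * E + star E * (- t%:C *: E)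
    = (2 * t)%:C *: (- (star E * E)).
  rewrite (_ : (2 * t)%:C = t%:C + t%:C); last by rewrite -rmorphD mulr_natl mulr2n.
  by rewrite scaleNr starN starZR; expand; lin.
rewrite scalerDr scalerA -rmorphM mulVf ?gt_eqF // scale1r opprD addNKr nrmN nrmZR.
have te : t * e = nrm F + 1 by rewrite divfK ?gt_eqF.
rewrite ger0_norm ?invr_ge0 ?(ltW c0) // ler_pdivrMl // -mulrA te.
by have := nrm_ge0 F; lra.
Qed.

End Corner.

(** * Values on scalars *)

Section Scalars.
Context {R : realType} {A B : cstarAlgType R} (Phi : A -> B).
Hypotheses (Phi_cont : continuous Phi).
Hypotheses (Phi0 : Phi 0 = 0) (Phi1 : Phi 1 = 1) (Phi4 : gram_positive 4 Phi).
Implicit Types (x y a b c : A) (p : B) (s t e : R).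

Definition scl {C : cstarAlgType R} t : C := t%:C *: (1 : C).

Lemma sclD {C : cstarAlgType R} s t : scl (s + t) = scl s + scl t :> C.
Proof. by rewrite /scl rmorphD scalerDl. Qed.

Lemma sclM {C : cstarAlgType R} s t : scl (s * t) = s%:C *: scl t :> C.
Proof. by rewrite /scl rmorphM scalerA. Qed.

Lemma scl_sqr t : 0 <= t ->
  scl t = star (scl (Num.sqrt t)) * scl (Num.sqrt t) :> A.
Proof.
move=> t0; rewrite /scl starZR star1 mulZl mulZr mul1r scalerA -rmorphM.
by rewrite -expr2 sqr_sqrtr.
Qed.

Definition fixed t : Prop := Phi (scl t) = scl t.
Definition below t : Prop := nneg (scl t - Phi (scl t)).

Lemma fixed_below t : fixed t -> below t.
Proof. by rewrite /below => ->; rewrite subrr; exact: nneg0. Qed.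

Lemma fixed0 : fixed 0. Proof. by rewrite /fixed /scl !scale0r. Qed.
Lemma fixed1 : fixed 1. Proof. by rewrite /fixed /scl !scale1r. Qed.

Lemma scalar_convex t s : 0 <= t -> 0 <= s ->
  nneg (Phi (scl (t + s + s)) - Phi (scl (t + s)) *+ 2 + Phi (scl t)).
Proof.
move=> t0 s0.
have := strongly_superadditive _ Phi4 (scl (Num.sqrt t)) (scl (Num.sqrt s)) (scl (Num.sqrt s)).
by rewrite /= -!scl_sqr // -!sclD mulr2n opprD addrA.
Qed.

(** Convexity of [t |-> Phi t] on the scalars [t], [t + s], [t + 2 s]. *)
Lemma below_mid t s : 0 <= t -> 0 <= s -> below t -> below (t + s + s) -> below (t + s).
Proof.
move=> t0 s0 bt bts; rewrite /below -[X in nneg X]scale_halfK.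
apply: nnegZ; first by rewrite invr_ge0.
have := nnegD _ _ (nnegD _ _ bt bts) (scalar_convex _ _ t0 s0).
by congr nneg; rewrite !sclD; lin.
Qed.

Lemma below_dyadic u n (j : nat) : 0 <= u -> fixed u -> (j <= 2 ^ n)%N ->
  below (j%:R * (u / (2 ^ n)%:R)).
Proof.
move=> u0 fu; elim: n j => [|n IHn] j.
  rewrite expn0 divr1; case: j => [|[|//]] _; rewrite ?mul0r ?mul1r.
    by apply: fixed_below; exact: fixed0.
  exact: fixed_below.
pose d := u / (2 ^ n.+1)%:R.
have d0 : 0 <= d by rewrite divr_ge0.
have dE : u / (2 ^ n)%:R = d + d.
  rewrite /d expnS natrM invfM; have := pnatr_eq0 R (2 ^ n); rewrite expn_eq0 /= => h.
  by field; rewrite h.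
move=> jn; rewrite -/d -(odd_double_half j).
have [|i_le] := boolP (odd j); last first.
  rewrite add0n -muln2 natrM -mulrA (_ : 2 * d = u / (2 ^ n)%:R); last by rewrite dE; ring.
  apply: IHn; rewrite -(leq_pmul2l (m := 2)) // -expnS mul2n.
  by apply: leq_trans jn; rewrite -{2}(odd_double_half j) leq_addl.
move=> oj.
have jlt : (j./2.+1 <= 2 ^ n)%N.
  rewrite -(leq_pmul2l (m := 2)) // -expnS mul2n doubleS.
  have : (j < 2 ^ n.+1)%N.
    rewrite ltn_neqAle jn andbT; apply/eqP => E.
    by move: oj; rewrite E oddX.
  by rewrite -{1}(odd_double_half j) oj.
have -> : (true + j./2.*2)%:R * d = j./2.*2%:R * d + d.
  by rewrite natrD mulrDl mul1r addrC.
have e1 : j./2.*2%:R * d = j./2%:R * (u / (2 ^ n)%:R).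
  by rewrite dE -muln2 natrM; ring.
apply: below_mid => //; first by rewrite mulr_ge0.
- by rewrite e1; apply: IHn; exact: ltnW.
- rewrite e1 -addrA -dE -[X in _ + X]mul1r -mulrDl natr1; exact: IHn.
Qed.

(** A convex function below the diagonal at both ends of [[0, u]] is below it in between;
    dyadic points suffice since [Phi] is continuous and the cone is closed. *)
Lemma below_interval u t : 0 < u -> fixed u -> 0 <= t <= u -> below t.
Proof.
move=> u0 fu /andP[t0 tu]; apply: nneg_closed => e e0.
have e2 : 0 < e / 2 by rewrite divr_gt0.
have [d d0 Hd] := continuous_nrm Phi Phi_cont (scl t) _ e2.
pose m := Num.min d (e / 2).
have m0 : 0 < m by rewrite lt_min d0.
pose n := (Num.trunc (u / m)).+1.
have nu : u / m < n%:R by exact: truncnS_gt.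
have un : u / (2 ^ n)%:R < m.
  rewrite ltr_pdivrMr ?ltr0n ?expn_gt0 // mulrC -ltr_pdivrMr //.
  by apply: lt_trans nu _; rewrite ltr_nat ltn_expl.
set w := u / (2 ^ n)%:R in un *.
have w0 : 0 < w by rewrite divr_gt0 // ltr0n expn_gt0.
pose j := Num.trunc (t / w).
have /andP[jl ju] := truncn_itv (divr_ge0 t0 (ltW w0)).
rewrite -/j ler_pdivlMr // in jl.
rewrite -/j ltr_pdivrMr // -natr1 mulrDl mul1r in ju.
have jn : (j <= 2 ^ n)%N.
  rewrite -(ler_nat R) -(ler_pM2r w0) (le_trans jl) // (le_trans tu) //.
  by rewrite /w mulrCA divff ?mulr1 // pnatr_eq0 -lt0n expn_gt0.
exists (scl (j%:R * w) - Phi (scl (j%:R * w))).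
  exact: below_dyadic (ltW u0) fu jn.
have dist : nrm (scl t - scl (j%:R * w) : A) < m.
  rewrite -scalerBl -rmorphB.
  by apply: le_lt_trans un; apply: le_trans (nrm_scal _ _) _; lra.
have distB : nrm (scl t - scl (j%:R * w) : B) < m.
  rewrite -scalerBl -rmorphB.
  by apply: le_lt_trans un; apply: le_trans (nrm_scal _ _) _; lra.
move: dist distB; rewrite !lt_min => /andP[dA _] /andP[_ dB].
have := Hd _ dA => dPhi.
have -> : scl t - Phi (scl t) - (scl (j%:R * w) - Phi (scl (j%:R * w))) =
  (scl t - scl (j%:R * w)) - (Phi (scl t) - Phi (scl (j%:R * w))) by lin.
by apply: le_trans (nrmD _ _) _; rewrite nrmN; lra.
Qed.

(** Choi's multiplicative domain for [x = c^* 1]: the hypotheses say that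
    [Phi (x^* x) - Phi(x)^* Phi(x)] is zero, so in the Schur complement the off-diagonal
    entry [Phi (x^* y) - Phi(x)^* Phi(y)] is zero. *)
Lemma choi_scalar (c : R[i]) y :
    Phi (c *: (1 : A)) = c *: (1 : B) ->
    Phi ((c * c^*) *: (1 : A)) = (c * c^*) *: (1 : B) ->
  Phi (c *: y) = c *: Phi y.
Proof.
move=> fc fcc; pose x := c^* *: (1 : A).
have sx : star x = c *: (1 : A) by rewrite starZ conjCK star1.
have Phix : star (Phi x) = c *: (1 : B) by rewrite -positive_star // sx.
have Phix' : Phi x = c^* *: (1 : B) by rewrite -[LHS]starK Phix starZ star1.
apply/eqP; rewrite -subr_eq0; apply/eqP/corner_eq0 => p.
have := schur_form _ Phi1 Phi4 x y p.
have -> : star x * x = (c * c^*) *: (1 : A) by rewrite sx mulZl mulZr mul1r scalerA.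
rewrite fcc Phix Phix' sx !mulZl !mulZr !mul1r !scalerA subrr mulr0 mul0r add0r.
exact.
Qed.

End Scalars.

(** * Homogeneity *)

Section Homogeneity.
Context {R : realType} {A B : cstarAlgType R} (Phi : A -> B).
Hypotheses (Phi_cont : continuous Phi).
Hypotheses (Phi0 : Phi 0 = 0) (Phi1 : Phi 1 = 1) (Phi4 : gram_positive 4 Phi).
Implicit Types (x y a b c : A) (p : B) (s t e : R).

Local Notation fixed := (fixed Phi).
Local Notation below := (below Phi).

Lemma schwarz_scalar (c : R[i]) : Phi (c *: (1 : A)) = c *: (1 : B) ->
  nneg (Phi ((c^* * c) *: (1 : A)) - (c^* * c) *: (1 : B)).
Proof.
move=> fc; have := schwarz _ Phi1 Phi4 (c *: (1 : A)).
by rewrite fc !starZ !star1 !mulZl !mulZr !mul1r !scalerA.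
Qed.

Lemma conjR t : ((t%:C)^*)%R = t%:C :> R[i].
Proof. by rewrite conj_Creal // complex_real. Qed.

Lemma fixed_sqr t : fixed t -> below (t * t) -> fixed (t * t).
Proof.
move=> ft bt; apply/eqP; rewrite -subr_eq0.
apply/eqP/nneg_anti; last by rewrite opprB.
by have := schwarz_scalar _ ft; rewrite conjR -rmorphM.
Qed.

Lemma scale_fixed t y : fixed t -> fixed (t * t) -> Phi (t%:C *: y) = t%:C *: Phi y.
Proof.
by move=> ft ftt; apply: choi_scalar; rewrite ?conjR -?rmorphM //.
Qed.

(** Convexity at the midpoint [u] of [t] and [2 u - t]: being below the diagonal at
    [2 u - t] forces being above it at [t]. *)
Lemma fixed_of_below u t : fixed u -> 0 <= u -> 0 <= t <= u -> below t ->
  below (u + (u - t)) -> fixed t.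
Proof.
move=> fu u0 /andP[t0 tu] bt bs; apply/eqP; rewrite -subr_eq0.
apply/eqP/nneg_anti; last by rewrite opprB.
have ut0 : 0 <= u - t by rewrite subr_ge0.
have := nnegD _ _ bs (scalar_convex _ Phi4 _ _ t0 ut0).
congr nneg; rewrite subrKC fu.
have -> : scl (u + (u - t)) = scl u *+ 2 - scl t :> B.
  by rewrite /scl rmorphD rmorphB /=; lin.
by lin.
Qed.

(** Homogeneity for [b] rescales the bound [Phi t <= t] from [[0, 1]] to all [t >= 0]; then
    [fixed_of_below] applies with [u = 1]. *)
Lemma fixed_unit_interval (b : R) : 0 < b < 1 -> fixed b ->
  forall t, 0 <= t <= 1 -> fixed t.
Proof.
move=> /andP[b0 b1] fb.
have f1 : fixed 1 by exact: fixed1.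
have below01 t : 0 <= t <= 1 -> below t by exact: below_interval f1.
have fbb : fixed (b * b) by apply: fixed_sqr => //; apply: below01; nra.
have PhibX n y : Phi ((b ^+ n)%:C *: y) = (b ^+ n)%:C *: Phi y.
  elim: n => [|n IHn]; first by rewrite expr0 !scale1r.
  by rewrite exprS rmorphM /= -!scalerA scale_fixed // IHn.
have below_all t : 0 <= t -> below t.
  move=> t0; have [n bnt] : exists n, b ^+ n * t <= 1.
    pose d := b^-1 - 1.
    have d0 : 0 < d by rewrite subr_gt0 invf_gt1.
    have Bern n : n%:R * d <= b ^- n.
      elim: n => [|n IHn]; first by rewrite mul0r expr0 invr1.
      have : 1 <= b ^- n by rewrite invf_ge1 ?exprn_gt0 // exprn_ile1 // ltW.
      have -> : b ^- n.+1 = b ^- n * (1 + d) by rewrite exprSr invfM addrC subrK mulrC.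
      by rewrite -natr1; nra.
    exists (Num.trunc (t / d)).+1; set n := _.+1.
    have : t / d < n%:R by exact: truncnS_gt.
    rewrite ltr_pdivrMr // => tn.
    by rewrite mulrC -ler_pdivlMr ?exprn_gt0 // mul1r (le_trans (ltW tn)).
  have bn0 : 0 < b ^+ n by rewrite exprn_gt0.
  have : below (b ^+ n * t) by apply: below01; rewrite mulr_ge0 // ltW.
  rewrite /below !sclM PhibX -scalerBr => /(nnegZ (b ^+ n)^-1 _).
  rewrite scalerA -rmorphM mulVf ?gt_eqF // scale1r; apply.
  by rewrite invr_ge0 ltW.
move=> t t01; apply: (@fixed_of_below 1) => //; first exact: below01.
by apply: below_all; lra.
Qed.

Lemma scale_unit_interval (b : R) : 0 < b < 1 -> fixed b ->
  forall t y, 0 <= t <= 1 -> Phi (t%:C *: y) = t%:C *: Phi y.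
Proof.
move=> b01 fb t y t01; have F := fixed_unit_interval _ b01 fb.
by apply: scale_fixed; apply: F => //; nra.
Qed.

(** If [|al| < 1], the scalar [b = |al|^2] works: [Phi b <= b] by convexity and
    [Phi b >= Phi(al)^* Phi(al) = b] by the Schwarz inequality.  If [al > 1], convexity on
    [[0, al]] gives [Phi t <= t] there, and any [b] in the open unit interval
    with [2 - b <= al] works by [fixed_of_below] at [u = 1]. *)
Lemma fixed_below_one (al : R[i]) :
  `|al| <= 1 \/ 0 <= al -> `|al| <> 0 -> `|al| <> 1 ->
  Phi (al *: (1 : A)) = al *: (1 : B) -> exists2 b : R, 0 < b < 1 & fixed b.
Proof.
move=> al_dom al0 al1 fal.
have [al_lt1|al_ge1] := boolP (`|al| < 1).
  pose b := complex.Re (al^* * al)%R.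
  have bE : (al^* * al)%R = b%:C by rewrite RRe_real // ger0_real // mulrC mul_conjC_ge0.
  have b01 : 0 < b < 1.
    rewrite -!ltcR -bE mulrC -normCK expr_lt1 // al_lt1 andbT.
    by rewrite exprn_gt0 // lt_def normr_ge0 andbT; apply/eqP.
  exists b => //; apply/eqP; rewrite -subr_eq0; apply/eqP/nneg_anti.
    by rewrite /scl -bE; exact: schwarz_scalar.
  rewrite opprB; apply: (below_interval _ Phi_cont Phi0 Phi4 1) => //; first exact: fixed1.
  by lra.
have {al_dom} al_ge0 : 0 <= al.
  case: al_dom => // al_le1; case: al1; apply/eqP.
  by move: al_le1; rewrite le_eqVlt (negbTE al_ge1) orbF.
pose u := complex.Re al.
have alE : al = u%:C by rewrite RRe_real // ger0_real.
have u1 : 1 < u.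
  rewrite -ltcR -alE lt_def -[al](ger0_norm al_ge0); apply/andP; split; first exact/eqP.
  by rewrite real_leNgt ?normr_real ?real1.
have fu : fixed u by rewrite /fixed /scl -alE.
have bel t : 0 <= t <= u -> below t.
  by apply: below_interval => //; lra.
pose b := Num.max 2^-1 (2 - u).
have b1 : b < 1 by rewrite gt_max; apply/andP; split; lra.
have b0 : 2^-1 <= b by rewrite le_max lexx.
have bu : 2 - u <= b by rewrite le_max lexx orbT.
exists b; first by lra.
apply: (@fixed_of_below 1); rewrite ?ler01 //; first exact: fixed1.
- by lra.
- by apply: bel; lra.
- by apply: bel; lra.
Qed.

End Homogeneity.

(** * Superadditivity of the 2x2 amplification *)

Section Superadditivity2.
Context {R : realType} {A B : cstarAlgType R} (Phi : A -> B).
Hypotheses (Phi0 : Phi 0 = 0).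
Implicit Types (x y : A) (p : B).

(** The form of [Phi_2 (X + Y) - Phi_2 X - Phi_2 Y] with coefficients [(p, 1)], where [X] and
    [Y] are the Gram matrices of the rows [(1, x)] and [(1, y)]. *)
Definition superadditive2 : Prop := forall x y p, nneg (
    star p * (Phi (1 + 1) - Phi 1 - Phi 1) * p
  + star p * (Phi (x + y) - Phi x - Phi y)
  + (Phi (star x + star y) - Phi (star x) - Phi (star y)) * p
  + (Phi (star x * x + star y * y) - Phi (star x * x) - Phi (star y * y))).

(** Monotonicity on 2x2 blocks for [X+Y, X; X, X] above [Y, 0; 0, 0], whose difference has
    all blocks equal to [X]; the block signs [(1, -1)] leave
    [Phi_2 (X + Y) - Phi_2 X - Phi_2 Y]. *)
Lemma Smon_plus4_superadditive2 : Smon_plus 4 Phi -> superadditive2.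
Proof.
move=> mono x y p.
pose v := nth (row4 0 0 0 0) [:: row4 1 x 1 x].
pose w := nth (row4 0 0 0 0) [:: row4 1 y 0 0].
have := Smon_form _ _ Phi 4 v w 1 1 (row4 p 1 (- p) (-1)) mono isT isT.
congr nneg; rewrite /v /w; unfold_form; rewrite Phi0 ?subr0.
expand; lin.
Qed.

(** The blocks of the 6x6 matrix are [a_i a_j X + b_i b_j Y] for the three points
    [(a, b) = (1, 0), (0, 1), (1, 1)] of the plane.  The linear relation with
    coefficients [(1, 1, -1)] between these points makes the form vanish on additive
    maps, and in general it leaves [Phi_2 (X + Y) - Phi_2 X - Phi_2 Y]. *)
Lemma n_positive6_superadditive2 : n_positive 6 Phi -> superadditive2.
Proof.
move=> Phi6 x y p.
pose v := nth (fun=> 0) [:: nth 0 [:: 1; x; 0; 0; 1; x]; nth 0 [:: 0; 0; 1; y; 1; y]].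
pose k := nth 0 [:: p; 1; p; 1; - p; -1].
have := n_positive_gram _ _ _ _ 6 Phi6 isT 2 v k isT.
congr nneg; rewrite /v /k; unfold_form; rewrite Phi0.
expand; lin.
Qed.

End Superadditivity2.

(** * Additivity *)

Section Additivity.
Context {R : realType} {A B : cstarAlgType R} (Phi : A -> B).
Hypotheses (Phi_cont : continuous Phi).
Hypotheses (Phi0 : Phi 0 = 0) (Phi1 : Phi 1 = 1) (Phi4 : gram_positive 4 Phi).
Hypothesis Phi_scale : forall (t : R) (y : A), 0 <= t <= 1 ->
  Phi (t%:C *: y) = t%:C *: Phi y.
Implicit Types (x y a b c : A) (p : B) (s t e : R).

(** By strong superadditivity the increments of [n |-> Phi (P + n Q)] are at least the
    first one. *)
Lemma positive_increment a b (n : nat) :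
  let P := star a * a in let Q := star b * b in
  nneg (Phi (P + Q *+ n) - Phi P - (Phi (P + Q) - Phi P) *+ n).
Proof.
move=> P Q; elim: n => [|n IHn].
  by rewrite mulr0n addr0 mulr0n subr0 subrr; exact: nneg0.
have := strongly_superadditive _ Phi4 a b ((Num.sqrt n%:R)%:C *: b).
rewrite /= -/P -/Q starZR mulZl mulZr scalerA -rmorphM -expr2 sqr_sqrtr // rmorph_nat.
rewrite -/Q scaler_nat => /(nnegD _ _ IHn); congr nneg.
by rewrite !mulrS (addrA P); lin.
Qed.

(** The error made by replacing [Phi (P / n + Q) - Phi(P) / n] by [Phi(Q)]. *)
Lemma split_error t (u v w z : B) :
  - (u - v - w) - (z - t%:C *: v - (u - v)) = (w - z) + t%:C *: v.
Proof. by lin. Qed.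

(** Superadditivity is one half.  For the other, divide [positive_increment] by [n] and use
    homogeneity: [Phi (P / n + Q) - Phi(P) / n >= Phi (P + Q) - Phi(P)], where the left
    side tends to [Phi(Q)] by continuity. *)
Lemma additive_on_positives a b :
  Phi (star a * a + star b * b) = Phi (star a * a) + Phi (star b * b).
Proof.
apply/eqP; rewrite -subr_eq0 opprD addrA; apply/eqP/nneg_anti.
  exact: superadditive.
set P := star a * a; set Q := star b * b.
apply: nneg_closed => e e0.
have e2 : 0 < e / 2 by rewrite divr_gt0.
have [d d0 Hd] := continuous_nrm Phi Phi_cont Q _ e2.
pose m := Num.min (d / (nrm P + 1)) ((e / 2) / (nrm (Phi P) + 1)).
have P1 : 0 < nrm P + 1 by rewrite ltr_wpDl ?nrm_ge0.
have PhiP1 : 0 < nrm (Phi P) + 1 by rewrite ltr_wpDl ?nrm_ge0.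
have m0 : 0 < m by rewrite lt_min !divr_gt0.
pose n := (Num.trunc m^-1).+1; pose t : R := n%:R^-1.
have n0 : 0 < n%:R :> R by rewrite ltr0n.
have t0 : 0 < t by rewrite invr_gt0.
have tm : t < m by rewrite invf_plt ?posrE //; exact: truncnS_gt.
have t01 : 0 <= t <= 1 by rewrite ltW //= invf_le1 // ler1n.
have tn : t%:C * n%:R = 1 by rewrite -(rmorph_nat (real_complex R)) -rmorphM mulVf ?gt_eqF.
have scale_n (C : cstarAlgType R) (z : C) : t%:C *: (z *+ n) = z.
  by rewrite -scaler_nat scalerA tn scale1r.
move: tm; rewrite lt_min !ltr_pdivlMr // => /andP[tP tPhiP].
exists (t%:C *: (Phi (P + Q *+ n) - Phi P - (Phi (P + Q) - Phi P) *+ n)).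
  by apply: nnegZ (positive_increment a b n); exact: ltW.
rewrite !scalerBr scale_n -Phi_scale // scalerDr scale_n.
rewrite split_error.
apply: le_trans (nrmD _ _) _; rewrite nrmZR gtr0_norm //.
have := Hd (t%:C *: P + Q); rewrite opprD addrCA subrr addr0 nrmN nrmZR gtr0_norm //.
have := nrm_ge0 P; have := nrm_ge0 (Phi P) => H1 H2.
have tP' : t * nrm P < d by lra.
by move=> /(_ tP'); lra.
Qed.

Hypothesis Phi_superadd2 : superadditive2 Phi.

(** The defect of additivity of the 2x2 amplification on the matrices with entries
    [1, x; x^*, x^* x] and [1, y; y^*, y^* y] is nonnegative and, by additivity on positive
    elements, has zero diagonal. *)
Lemma additive_of_superadditive2 x y : Phi (x + y) = Phi x + Phi y.
Proof.
apply/eqP; rewrite -subr_eq0 opprD addrA; apply/eqP/(@corner_eq0 _ _ _ 0) => p.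
have := Phi_superadd2 x y p; rewrite additive_on_positives.
have -> : Phi (1 + 1) = Phi 1 + Phi 1.
  by have := additive_on_positives 1 1; rewrite star1 mulr1.
have -> : Phi (star x + star y) - Phi (star x) - Phi (star y)
    = star (Phi (x + y) - Phi x - Phi y).
  by rewrite -(starD x y) !(positive_star Phi Phi1 Phi4) !(starD, starN).
by rewrite addrK subrr mulr0 mul0r add0r [_ + _ - Phi (star x * x)]addrC addKr subrr.
Qed.

Lemma real_scale t x : Phi (t%:C *: x) = t%:C *: Phi x.
Proof.
have PhiN z : Phi (- z) = - Phi z.
  by apply: (addrI (Phi z)); rewrite -additive_of_superadditive2 !subrr Phi0.
have PhiMn z n : Phi (z *+ n) = Phi z *+ n.
  by elim: n => [|n IHn]; rewrite ?mulr0n // !mulrS additive_of_superadditive2 IHn.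
wlog t0 : t / 0 <= t => [H|].
  have [t0|t0] := leP 0 t; first exact: H.
  have -> : t = - - t by rewrite opprK.
  by rewrite rmorphN !scaleNr PhiN H // oppr_ge0 ltW.
pose n := (Num.trunc t).+1.
have tn : t < n%:R by exact: truncnS_gt.
have n0 : 0 < n%:R :> R by rewrite ltr0n.
have -> : t = n%:R * (t / n%:R) by rewrite mulrC divfK ?gt_eqF.
rewrite rmorphM rmorph_nat -!scalerA !scaler_nat PhiMn Phi_scale //.
by rewrite divr_ge0 ?(ltW n0) //= ler_pdivrMr // mul1r ltW.
Qed.

End Additivity.

(** * The theorem *)

Theorem theorem4p4 (R : realType) (A B : cstarAlgType R) (Phi : A -> B)
    (Phi_cont : continuous Phi) (Phi_unital : Phi 1 = 1)
    (Phi_pos : positive_map Phi) (Phi0 : Phi 0 = 0)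
    (Phi_class : n_positive 6 Phi \/ Smon_plus 4 Phi) :
  ((exists alpha : R[i],
      [/\ `|alpha| <= 1 \/ 0 <= alpha, `|alpha| <> 0, `|alpha| <> 1
        & Phi (alpha *: (1 : A)) = alpha *: (1 : B)]) ->
    forall (beta : R) (a b : A),
      Phi (beta%:C *: a + b) = beta%:C *: Phi a + Phi b)
  /\
  ((exists r s : R,
      [/\ `|r +i* s| <> 0, `|r +i* s| < 1, s <> 0
        & Phi ((r +i* s) *: (1 : A)) = (r +i* s) *: (1 : B)]) ->
    linear Phi).
Proof.
have Phi4 : gram_positive 4 Phi.
  case: Phi_class => [Phi6|mono]; first exact: (n_positive_gram _ _ _ _ _ Phi6).
  exact: (n_positive_gram _ _ _ _ _ (Smon_n_positive _ _ _ _ Phi0 mono)).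
have Phi22 : superadditive2 Phi.
  by case: Phi_class; [exact: n_positive6_superadditive2 | exact: Smon_plus4_superadditive2].
have real_linear : (exists alpha : R[i],
      [/\ `|alpha| <= 1 \/ 0 <= alpha, `|alpha| <> 0, `|alpha| <> 1
        & Phi (alpha *: (1 : A)) = alpha *: (1 : B)]) ->
    forall (beta : R) (a b : A),
      Phi (beta%:C *: a + b) = beta%:C *: Phi a + Phi b.
  case=> al [al_dom al0 al1 fal] beta a b.
  have [g g01 fg] := fixed_below_one _ Phi_cont Phi0 Phi_unital Phi4 _ al_dom al0 al1 fal.
  have sc := scale_unit_interval _ Phi_cont Phi0 Phi_unital Phi4 _ g01 fg.
  rewrite (additive_of_superadditive2 _ Phi_cont Phi0 Phi_unital Phi4 sc Phi22).
  by rewrite (real_scale _ Phi_cont Phi0 Phi_unital Phi4 sc Phi22).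
split=> // -[r [s [al0 al1 s0 fal]]].
set al := r +i* s in al0 al1 fal.
have al_dom : `|al| <= 1 \/ 0 <= al by left; exact: ltW.
have al_neq1 : `|al| <> 1 by move=> E; move: al1; rewrite E ltxx.
have rl : forall (beta : R) (a b : A), Phi (beta%:C *: a + b) = beta%:C *: Phi a + Phi b.
  by apply: real_linear; exists al.
have [g g01 fg] := fixed_below_one _ Phi_cont Phi0 Phi_unital Phi4 _ al_dom al0 al_neq1 fal.
have F := fixed_unit_interval _ Phi_cont Phi0 Phi_unital Phi4 _ g01 fg.
have al_mul y : Phi (al *: y) = al *: Phi y.
  apply: choi_scalar => //.
  have alE : (al * al^*)%R = (complex.Re (al * al^*)%R)%:C.
    by rewrite RRe_real // ger0_real // mul_conjC_ge0.
  rewrite alE; apply: F.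
  by rewrite -!lecR -alE mul_conjC_ge0 -normCK expr_le1 // ltW.
have PhiZ t y : Phi (t%:C *: y) = t%:C *: Phi y.
  by have := rl t y 0; rewrite Phi0 !addr0.
have PhiD y z : Phi (y + z) = Phi y + Phi z.
  by have := rl 1 y z; rewrite !scale1r.
have alC : al = (r%:C + s%:C * 'i)%R by rewrite [al]complexE complexiE [('i * _)%R]mulrC.
have Phii y : Phi ('i%R *: y) = 'i%R *: Phi y.
  have := al_mul y; rewrite alC !scalerDl PhiD PhiZ => /addrI.
  rewrite -!scalerA PhiZ => /(congr1 (fun z => s^-1%:C *: z)).
  have sK (z : B) : s^-1%:C *: (s%:C *: z) = z.
    by rewrite scalerA -rmorphM mulVf ?scale1r //; exact/eqP.
  by rewrite !sK.
move=> c y z; rewrite PhiD; congr (_ + _).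
have -> : c = ((complex.Re c)%:C + (complex.Im c)%:C * 'i)%R.
  by rewrite {1}[c]complexE complexiE [('i * _)%R]mulrC.
by rewrite !scalerDl PhiD PhiZ -!scalerA PhiZ Phii.
Qed.
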